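(* Let $X$ and $Y$ be complex topological vector spaces, and assume that $\Gamma\subset\mathcal{B}(X)$ and $\Gamma_1\subset\mathcal{B}(Y)$ are similar. Then $\Gamma$ is a diskcyclic transitive set in $X$ if and only if $\Gamma_1$ is a diskcyclic transitive set in $Y$.
   Context: $\mathcal{B}(X)$ is the set of all continuous linear operators on $X$, and $\mathbb{D}=\{\alpha\in\mathbb{C}:|\alpha|\le 1\}$. $\Gamma$ and $\Gamma_1$ are called similar if there exists a continuous linear operator $\phi:X\to Y$ that is a homeomorphism and such that for all $T\in\Gamma$ there exists $S\in\Gamma_1$ satisfying $S\circ\phi=\phi\circ T$. A vector $x\in X$ is a diskcyclic vector for $\Gamma$ if $\{\alpha Tx:\alpha\in\mathbb{D},\,T\in\Gamma\}$ is dense in $X$; $\mathbb{D}C(\Gamma)$ is the set of all diskcyclic vectors for $\Gamma$. $\Gamma$ is diskcyclic transitive if $\mathbb{D}C(\Gamma)=X\setminus\{0\}$ (similarly for $\Gamma_1$ on $Y$).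
   Formalization: ''Similar'' is required in both directions (Γ to Γ₁ and Γ₁ to Γ, possibly by different homeomorphisms), also for the forward implication; with the one-directional definition the claim fails for X=Y=ℂ, Γ={id}, Γ₁=B(ℂ). *)

(* Defs.v *)
From HB Require Import structures.
From mathcomp Require Import all_boot all_order all_algebra.
From mathcomp Require Import complex.
From mathcomp Require Import all_classical all_reals all_analysis.

Set Implicit Arguments.
Unset Strict Implicit.
Unset Printing Implicit Defensive.

Import Order.TTheory GRing.Theory Num.Theory.
Import numFieldNormedType.Exports.

Local Open Scope classical_set_scope.
Local Open Scope ring_scope.
Local Open Scope complex_scope.

(* The scalar field is [R[i]] with [R : realType].  A complex topological
   vector space is a [topologicalLmodType R[i]]; the library's [tvsType] would
   in addition require local convexity. *)

Definition continuous_operators (R : realType) (X : topologicalLmodType R[i]) :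
    set {linear X -> X} :=
  [set T : {linear X -> X} | continuous T].

Definition homeomorphism (T U : topologicalType) (f : T -> U) : Prop :=
  continuous f /\
  exists g : U -> T, [/\ cancel f g, cancel g f & continuous g].

Definition unit_disk (R : realType) : set R[i] :=
  [set alpha : R[i] | `|alpha| <= 1].

Definition disk_orbit (R : realType) (X : topologicalLmodType R[i])
    (Gamma : set {linear X -> X}) (x : X) : set X :=
  [set y | exists (alpha : R[i]) (T : {linear X -> X}),
     [/\ unit_disk alpha, Gamma T & y = alpha *: T x]].

Definition diskcyclic_vectors (R : realType) (X : topologicalLmodType R[i])
    (Gamma : set {linear X -> X}) : set X :=
  [set x | dense (disk_orbit Gamma x)].

Definition diskcyclic_transitive (R : realType) (X : topologicalLmodType R[i])
    (Gamma : set {linear X -> X}) : Prop :=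
  diskcyclic_vectors Gamma = [set: X] `\ 0.

Definition one_sided_similar (R : realType) (X Y : topologicalLmodType R[i])
    (Gamma : set {linear X -> X}) (Gamma1 : set {linear Y -> Y}) : Prop :=
  exists phi : {linear X -> Y}, homeomorphism phi /\
    forall T, Gamma T -> exists2 S, Gamma1 S & S \o phi =1 phi \o T.

(* [one_sided_similar] is one-directional: it only says that every operator of [Gamma]
   has a conjugate in [Gamma1], so it holds for any [Gamma `<=` Gamma1] on the
   same space, and diskcyclic transitivity of [Gamma1] does not then pass to
   [Gamma] (on C, take [Gamma = {id}] and [Gamma1] all operators).  "[Gamma] and
   [Gamma1] are similar" is therefore read as a symmetric relation. *)
Definition similar_sets (R : realType) (X Y : topologicalLmodType R[i])
    (Gamma : set {linear X -> X}) (Gamma1 : set {linear Y -> Y}) : Prop :=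
  one_sided_similar Gamma Gamma1 /\ one_sided_similar Gamma1 Gamma.

(* Main.v *)
(** A similarity [phi] from [Gamma] to [Gamma1] maps disk orbits into disk
    orbits, hence diskcyclic vectors to diskcyclic vectors.  The similarity
    [Gamma -> Gamma1] is bijective and so reaches every nonzero vector of [Y];
    the reverse one shows that [0] is not diskcyclic for [Gamma1] unless it is
    so for [Gamma]. *)
Require Import Defs.
From mathcomp Require Import all_boot all_order all_algebra.
From mathcomp Require Import complex.
From mathcomp Require Import all_classical all_reals all_analysis.

Local Open Scope classical_set_scope.
Local Open Scope ring_scope.
Local Open Scope complex_scope.

(** The preimage of a nonempty open set is open by continuity and nonempty by surjectivity, so it
    meets [A]. *)
Lemma dense_image (T U : topologicalType) (f : T -> U) (A : set T) :
  continuous f -> range f = setT -> dense A -> dense (f @` A).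
Proof.
move=> cf fsurj dA O [u Ou] oO.
have [t _ ftu] : range f u by rewrite fsurj.
have [|s [Ofs As]] := dA (f @^-1` O) _ (open_comp (fun s _ => cf s) oO).
  by exists t; rewrite /preimage /= ftu.
by exists (f s); split=> //; exists s.
Qed.

Lemma subset_dense (T : topologicalType) (A B : set T) :
  A `<=` B -> dense A -> dense B.
Proof.
by move=> AB dA O O0 oO; have [t [Ot At]] := dA O O0 oO; exists t; split=> //; apply: AB.
Qed.

(** Linearity of [phi] keeps the same scalar in the disk, and [T] is replaced by its conjugate
    [S]. *)
Lemma disk_orbit_intertwine (R : realType) (X Y : topologicalLmodType R[i])
    (Gamma : set {linear X -> X}) (Gamma1 : set {linear Y -> Y})
    (phi : {linear X -> Y}) (x : X) :
  (forall T, Gamma T -> exists2 S, Gamma1 S & S \o phi =1 phi \o T) ->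
  phi @` disk_orbit Gamma x `<=` disk_orbit Gamma1 (phi x).
Proof.
move=> phiP _ [_ [a [T [a1 GT ->]] <-]].
have [S GS Sphi] := phiP T GT.
by exists a, S; split=> //; rewrite GRing.linearZ; congr (_ *: _); rewrite -[LHS]Sphi.
Qed.

Lemma diskcyclic_vectors_similar (R : realType) (X Y : topologicalLmodType R[i])
    (Gamma : set {linear X -> X}) (Gamma1 : set {linear Y -> Y})
    (phi : {linear X -> Y}) (x : X) :
  homeomorphism phi ->
  (forall T, Gamma T -> exists2 S, Gamma1 S & S \o phi =1 phi \o T) ->
  diskcyclic_vectors Gamma x -> diskcyclic_vectors Gamma1 (phi x).
Proof.
move=> [cphi [g [_ gK _]]] phiP dx.
(* The orbit of [phi x] contains the [phi]-image of a dense orbit, which is dense since [phi] is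
   continuous and onto. *)
apply: subset_dense _ _ _ (disk_orbit_intertwine _ _ _ _ _ _ x phiP) _.
by apply: dense_image => //; apply/seteqP; split=> // y _; exists (g y).
Qed.

(** The hypotheses are symmetric in the two sets, so this implication also gives the converse by
    exchanging them. *)
Lemma diskcyclic_transitive_similar (R : realType)
    (X Y : topologicalLmodType R[i])
    (Gamma : set {linear X -> X}) (Gamma1 : set {linear Y -> Y}) :
  one_sided_similar Gamma Gamma1 -> one_sided_similar Gamma1 Gamma ->
  diskcyclic_transitive Gamma -> diskcyclic_transitive Gamma1.
Proof.
move=> [phi [hphi phiP]] [psi [hpsi psiP]] GT.
apply/seteqP; split=> [y dy|y [_ /= y0]].
  split=> //= y0.
  (* If [y = 0] were diskcyclic for [Gamma1], then [psi 0 = 0] would be diskcyclic for [Gamma]. *)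
  have := diskcyclic_vectors_similar _ _ _ _ _ _ _ hpsi psiP dy.
  by rewrite y0 GRing.linear0 GT => -[_]; apply.
have [_ [g [_ gK _]]] := hphi.
(* Write [y] as [phi (g y)]; here [g y] is nonzero, since otherwise [y = phi 0 = 0], hence
   diskcyclic for [Gamma]. *)
rewrite -(gK y); apply: diskcyclic_vectors_similar _ _ _ _ _ _ _ hphi phiP _.
rewrite GT; split=> //= gy0.
by apply: y0; rewrite -(gK y) gy0 GRing.linear0.
Qed.

Theorem proposition3p17 (R : realType) (X Y : topologicalLmodType R[i])
    (Gamma : set {linear X -> X}) (Gamma1 : set {linear Y -> Y})
    (hGamma : Gamma `<=` @continuous_operators R X)
    (hGamma1 : Gamma1 `<=` @continuous_operators R Y)
    (hsim : similar_sets Gamma Gamma1) :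
  diskcyclic_transitive Gamma <-> diskcyclic_transitive Gamma1.
Proof. by case: hsim => h h1; split; apply: diskcyclic_transitive_similar. Qed.
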